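(* Let $p>2$ be prime and let $1\leq k_1<\cdots<k_s$ be integers with $k_s>1$. Let $r=\lfloor\log_2(k_s)\rfloor+1$. Then $$\pi^{*}_{k_1,\ldots,k_s}(p)=\pi^{*}_{2^{r-1}}(p).$$
   Context: For integers $1\leq k_1<\cdots<k_s$ and $n\geq 1$, put $$S(\sigma_{n,[k_1,\ldots,k_s]})=\sum_{j=0}^n(-1)^{\binom{j}{k_1}+\cdots+\binom{j}{k_s}}\binom{n}{j}.$$ (For $n\ge k_s$ this is $\sum_{x\in\mathbb{F}_2^n}(-1)^{f(x)}$, where $f=\sigma_{n,k_1}+\cdots+\sigma_{n,k_s}$ is a sum of elementary symmetric polynomials over $\mathbb{F}_2$.) The integer sequence $\{S(\sigma_{n,[k_1,\ldots,k_s]})\}_{n\geq 1}$ satisfies a homogeneous linear recurrence with integer coefficients. When $k_s>1$ the sequence is not identically zero; let $x_n=a_1x_{n-1}+\cdots+a_dx_{n-d}$ be the minimal-order such recurrence with integer coefficients that it satisfies, let $\chi_{k_1,\ldots,k_s}(t)=t^d-a_1t^{d-1}-\cdots-a_d$ be its characteristic polynomial, and let $A(k_1,\ldots,k_s)$ be its $d\times d$ companion matrix. It is known that $\chi_{k_1,\ldots,k_s}(t)$ is a product of distinct factors from the list $t-2,\Phi_4(t-1),\Phi_8(t-1),\ldots,\Phi_{2^r}(t-1)$, where $r=\lfloor\log_2(k_s)\rfloor+1$ and $\Phi_m$ is the $m$-th cyclotomic polynomial, and that $\Phi_{2^r}(t-1)$ always occurs. Hence $\det A(k_1,\ldots,k_s)$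 is, up to sign, a power of 2, and $A(k_1,\ldots,k_s)$ is invertible modulo every odd prime $p$. The weak Pisano period $\pi^*_{k_1,\ldots,k_s}(p)$ is the multiplicative order of $A(k_1,\ldots,k_s)$ modulo $p$, i.e. the least $N\ge1$ with $A(k_1,\ldots,k_s)^N\equiv I \pmod p$. The case $s=1$, $k_1=k$ is written $\pi^*_k(p)$. *)

(* Defs.v *)
From mathcomp Require Import all_boot all_order all_algebra.

Set Implicit Arguments.
Unset Strict Implicit.
Unset Printing Implicit Defensive.

Import GRing.Theory.
Local Open Scope ring_scope.

(* For n >= max ks this is the sum over x in F_2^n of (-1)^f(x), f being the sum
   of the elementary symmetric polynomials of degrees k in ks: on an x of
   weight j, the one of degree k takes the value 'C(j, k) mod 2. *)
Definition expsum (ks : seq nat) (n : nat) : int :=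
  \sum_(j < n.+1) (-1) ^+ (\sum_(k <- ks) 'C(j, k))%N * 'C(n, j)%:Z.

(* Sequences are indexed from 1: the value x 0 plays no role, so the first
   instance of a recurrence of order d = size a is the one for x (d + 1).
   The entry a`_i is the coefficient a_(i+1) of x_(n - (i+1)). *)
Definition satisfies_recurrence (x : nat -> int) (a : seq int) : Prop :=
  forall n : nat, (size a < n)%N ->
    x n = \sum_(i < size a) a`_i * x (n - i.+1)%N.

Definition minimal_recurrence (x : nat -> int) (a : seq int) : Prop :=
  satisfies_recurrence x a /\
  forall b : seq int, satisfies_recurrence x b -> (size a <= size b)%N.

Definition recurrence_poly (a : seq int) : {poly int} :=
  'X^(size a) - \sum_(i < size a) a`_i *: 'X^(size a - i.+1).

Definition mx_one_mod (p d : nat) (A : 'M[int]_d) : Prop :=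
  forall i j : 'I_d, (A i j = (1%:M : 'M[int]_d) i j %[mod p%:Z])%Z.

Definition mx_order_mod (p d : nat) (A : 'M[int]_d) (N : nat) : Prop :=
  [/\ (0 < N)%N, mx_one_mod p (A ^+ N)
    & forall M : nat, (0 < M)%N -> mx_one_mod p (A ^+ M) -> (N <= M)%N].

(* The period exists and equals N.  This includes the existence and uniqueness
   of the minimal recurrence; when they or the order fail, no N qualifies, and
   there is never more than one N (weak_pisano_period_inj). *)
Definition weak_pisano_period (p : nat) (ks : seq nat) (N : nat) : Prop :=
  exists2 a : seq int, unique (minimal_recurrence (expsum ks)) a
    & mx_order_mod p (companionmx (recurrence_poly a)) N.

Lemma weak_pisano_period_inj (p : nat) (ks : seq nat) (N M : nat) :
  weak_pisano_period p ks N -> weak_pisano_period p ks M -> N = M.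
Proof.
move=> [a [_ ua] [N0 AN minN]] [b [mb _] [M0 AM minM]].
move: (ua b mb) => eab; subst b.
by apply/eqP; rewrite eqn_leq (minN _ M0 AM) (minM _ N0 AN).
Qed.

Lemma size_recurrence_poly (a : seq int) :
  size (recurrence_poly a) = (size a).+1.
Proof.
rewrite /recurrence_poly size_polyDl ?size_polyXn // size_polyN ltnS.
apply: (leq_trans (size_sum _ _ _)); apply/bigmax_leqP => i _.
by apply: (leq_trans (size_scale_leq _ _)); rewrite size_polyXn subnSK ?leq_subr.
Qed.

(* Main.v *)
Require Import Defs.
From HB Require Import structures.
From Stdlib Require Import Classical_Prop.
From mathcomp Require Import all_boot all_order all_algebra.
From mathcomp Require Import all_solvable all_field.

Set Implicit Arguments.
Unset Strict Implicit.
Unset Printing Implicit Defensive.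

Import Order.TTheory GRing.Theory Num.Theory.
Local Open Scope ring_scope.

(** Write S n for expsum ks n, e j for the sign (-1) ^ (sum of the 'C(j, k)),
    and let m be such that 2 ^ m <= k_s < 2 ^ m.+1. The period is shown to
    depend on m and p only.

    In characteristic zero: attach to a sequence x the linear form on
    polynomials that sends 'X^n to x n ([umbral]). The recurrences of x are then
    the monic polynomials of the ideal [annihilates x], and the binomial
    transform S of e has the form of e precomposed with 'X |-> 'X + 1
    ([annihilates_expsum]). By the Lucas congruence modulo 2, e has period
    2 ^ m.+1 but is reversed somewhere by a translation by 2 ^ m. Hence the
    ideal of the sequence S 1, S 2, ... contains the quotient by 'X of
    ('X - 1) ^ (2 ^ m.+1) - 1, and each of its members is a multiple of
    ('X - 1) ^ (2 ^ m) + 1, which is irreducible by the Eisenstein criterion.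
    The factor 'X disappears because indices start at 1. By the Gauss lemma the
    ideal is generated by a monic integer polynomial chi, the characteristic
    polynomial of the unique minimal recurrence ([minimal_recurrence_expsum]);
    chi lies, for divisibility, between the two polynomials just named.

    Modulo p: take a finite field L of characteristic p that contains a
    primitive root of unity of order 2 ^ m.+1. The roots of chi in L are simple
    and of the form 1 + u with u ^ (2 ^ m.+1) = 1 and u <> -1, and they include
    all those with u ^ (2 ^ m) = -1. The identity
    1 - v ^ 2 = (1 + v) * (1 - v) shows that if (1 + u) ^ N = 1 holds for the u
    of the largest order 2 ^ m.+1, it holds for those of order 2 ^ m, and so on
    down to u = 1 ([exp_1D_pow2_root]). So the companion matrix has N-th power 1
    modulo p exactly when (1 + u) ^ N = 1 for all u in L with u ^ (2 ^ m) = -1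
    ([mx_one_mod_companion]), a condition in which the k_i do not appear. *)

(** * Linear recurrences as an ideal of polynomials *)

Definition umbral (x : nat -> int) (q : {poly int}) : int :=
  \sum_(i < size q) q`_i * x i.

Lemma umbral_widen x n (q : {poly int}) :
  (size q <= n)%N -> umbral x q = \sum_(i < n) q`_i * x i.
Proof.
move=> le_q_n; rewrite /umbral (big_ord_widen n (fun i => q`_i * x i)) //.
rewrite big_mkcond; apply: eq_bigr => i _; case: ltnP => // le_q_i.
by rewrite nth_default ?mul0r.
Qed.

Lemma umbral_is_scalar x : scalar (umbral x).
Proof.
move=> c p q; set n := maxn (size p) (size q).
have le_pq : (size (c *: p + q)%R <= n)%N.
  rewrite (leq_trans (size_polyD _ _)) // geq_max leq_maxr andbT.
  by rewrite (leq_trans (size_scale_leq _ _)) ?leq_maxl.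
rewrite !(@umbral_widen x n) ?leq_maxl ?leq_maxr // mulr_sumr -big_split /=.
by apply: eq_bigr => i _; rewrite coefD coefZ mulrDl mulrA.
Qed.

HB.instance Definition _ x :=
  GRing.isLinear.Build int {poly int} int *%R (umbral x) (umbral_is_scalar x).

Lemma umbralXn x n : umbral x 'X^n = x n.
Proof.
rewrite (@umbral_widen x n.+1) ?size_polyXn // big_ord_recr /= coefXn eqxx.
by rewrite mul1r big1 ?add0r // => i _; rewrite coefXn ltn_eqF ?mul0r.
Qed.

Lemma umbral_shift x q : umbral (fun n => x n.+1) q = umbral x ('X * q).
Proof.
rewrite -[q]coefK poly_def mulr_sumr !raddf_sum; apply: eq_bigr => i _ /=.
by rewrite -scalerAr !linearZ /= -exprS !umbralXn.
Qed.

(** The form of the binomial transform sends 'X^n to the value of the form of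
    the original sequence at ('X + 1) ^ n. *)
Lemma umbral_binomial (x e : nat -> int) q :
    (forall n, x n = \sum_(j < n.+1) e j * 'C(n, j)%:Z) ->
  umbral x q = umbral e (q \Po ('X + 1)).
Proof.
move=> xE; rewrite -[in LHS](coefK q) poly_def comp_polyE !raddf_sum.
apply: eq_bigr => i _ /=; rewrite !linearZ /= umbralXn xE; congr (_ * _).
rewrite exprD1n raddf_sum; apply: eq_bigr => j _ /=.
by rewrite raddfMn /= umbralXn -mulr_natr natz.
Qed.

(** Testing all the multiples of q, rather than the q * 'X^n that are the
    instances of the recurrence, makes this an ideal by definition. *)
Definition annihilates (x : nat -> int) (q : {poly int}) : Prop :=
  forall h, umbral x (q * h) = 0.

Lemma annihilatesXn x q :
  (forall n, umbral x (q * 'X^n) = 0) -> annihilates x q.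
Proof.
move=> qX h; rewrite -[h]coefK poly_def mulr_sumr raddf_sum big1 // => i _ /=.
by rewrite -scalerAr linearZ /= qX mulr0.
Qed.

(** The shift from n to n.+1 accounts for recurrences constraining only the
    terms of positive index. *)
Lemma satisfies_recurrenceP x a :
  satisfies_recurrence x a <->
  annihilates (fun n => x n.+1) (recurrence_poly a).
Proof.
set y := fun n => _; set d := size a.
have E n : umbral y (recurrence_poly a * 'X^n)
           = x (n + d).+1 - \sum_(i < d) a`_i * x ((n + d).+1 - i.+1)%N.
  rewrite mulrBl raddfB /= -exprD umbralXn addnC; congr (_ - _).
  rewrite mulr_suml raddf_sum; apply: eq_bigr => i _ /=.
  rewrite -scalerAl linearZ /= -exprD umbralXn /y; congr (_ * x _).
  by rewrite subSS -addSn -subSn // subSS addnC -addnBA // ltnW.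
split=> [rec_a | ann_a n lt_d_n].
  apply: annihilatesXn => n.
  by rewrite E rec_a ?subrr // ltnS leq_addl.
have /eqP := ann_a 'X^(n - d.+1); rewrite E subr_eq0 -addnS subnK //.
by move/eqP.
Qed.

Lemma monic_recurrence_poly a : recurrence_poly a \is monic.
Proof.
rewrite monicE /lead_coef size_recurrence_poly /= /recurrence_poly.
rewrite coefB coefXn eqxx coef_sum big1 ?subr0 // => i _.
rewrite coefZ coefXn gtn_eqF ?mulr0 // ltn_subrL /=.
exact: leq_ltn_trans (ltn_ord i).
Qed.

Lemma coef_recurrence_poly a i : (i < size a)%N ->
  (recurrence_poly a)`_(size a - i.+1) = - a`_i.
Proof.
move=> lt_i; rewrite coefB coefXn ltn_eqF; last first.
  by rewrite ltn_subrL /= (leq_ltn_trans _ lt_i).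
rewrite sub0r coef_sum (bigD1 (Ordinal lt_i)) //= coefZ coefXn eqxx mulr1.
rewrite big1 ?addr0 // => j /eqP ne_ji; rewrite coefZ coefXn.
case: eqP => [e|_]; last by rewrite mulr0.
case: ne_ji; apply: val_inj => /=; apply: succn_inj.
by rewrite -(subKn lt_i) e subKn.
Qed.

Lemma recurrence_poly_inj : injective recurrence_poly.
Proof.
move=> a b e; have := congr1 (size \o polyseq) e.
rewrite /= !size_recurrence_poly => -[sab].
apply: (@eq_from_nth _ 0) => // i lt_i.
by apply: oppr_inj; rewrite -!coef_recurrence_poly -?sab // e.
Qed.

Lemma recurrence_poly_monic q : q \is monic -> exists a, recurrence_poly a = q.
Proof.
move=> mon_q; pose d := (size q).-1.
have sz_q : size q = d.+1 by rewrite prednK // size_poly_gt0 monic_neq0.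
pose a := mkseq (fun i => - q`_(d - i.+1)) d; exists a.
have sz_a : size a = d by rewrite size_mkseq.
apply/polyP => k; case: (ltngtP k d) => [lt_k | gt_k | ->].
- have lt_j : (d - k.+1 < d)%N by rewrite ltn_subrL /= (leq_ltn_trans _ lt_k).
  have := @coef_recurrence_poly a (d - k.+1); rewrite sz_a => /(_ lt_j).
  by rewrite nth_mkseq // opprK subnSK // subKn // ltnW.
- by rewrite !nth_default ?size_recurrence_poly ?sz_a ?sz_q.
have /monicP := monic_recurrence_poly a.
rewrite /lead_coef size_recurrence_poly sz_a => ->.
by move/monicP: mon_q; rewrite /lead_coef sz_q => ->.
Qed.

(** Sizes of annihilators form a set of natural numbers that is not decidable a
    priori, so its least element is obtained by excluded middle. *)
Lemma minimal_annihilator x g : g != 0 -> annihilates x g ->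
  exists m, [/\ m != 0, annihilates x m
    & forall q, q != 0 -> annihilates x q -> (size m <= size q)%N].
Proof.
have [n] := ubnP (size g); elim: n g => // n IHn g.
rewrite ltnS => le_g nz_g ann_g.
have [[q [nz_q ann_q lt_q]] | no_q] :=
  classic (exists q, [/\ q != 0, annihilates x q & (size q < size g)%N]).
  exact: (IHn q (leq_trans lt_q le_g)).
exists g; split=> // q nz_q ann_q; rewrite leqNgt; apply/negP => lt_q.
by apply: no_q; exists q.
Qed.

(** Pseudo-division shows that a nonzero annihilator m of least size divides all
    the others up to integer factors. By the Gauss lemma, the primitive part of
    m divides them over the integers. As it divides the monic g, its leading
    coefficient is a unit. *)
Lemma principal_annihilator x g : g \is monic -> annihilates x g ->
  exists2 chi, chi \is monic &
    forall q, annihilates x q <-> exists h, q = chi * h.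
Proof.
move=> mon_g ann_g.
have [m [nz_m ann_m min_m]] := minimal_annihilator (monic_neq0 mon_g) ann_g.
have dvd_m q : annihilates x q -> m %| q.
  move=> ann_q; apply: contraT => nz_r.
  suff /(min_m _ nz_r) : annihilates x (q %% m).
    by rewrite leqNgt Pdiv.Idomain.ltn_modp nz_m.
  have -> : q %% m = lead_coef m ^+ scalp q m *: q - m * (q %/ m).
    by rewrite Pdiv.Idomain.divp_eq mulrC addrAC subrr add0r.
  move=> h; rewrite mulrBl raddfB /= -scalerAl linearZ /= ann_q.
  by rewrite -mulrA ann_m mulr0 subr0.
have [r def_g] := dvdpP_int (dvd_m _ ann_g).
set z := zprimitive m in def_g.
have lead_z : (lead_coef z)^-1 * lead_coef z = 1.
  apply: mulVr; apply/unitrPr; exists (lead_coef r).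
  by rewrite -lead_coefM -def_g (monicP mon_g).
have nz_c : zcontents m != 0 by rewrite zcontents_eq0.
have ann_z : annihilates x z.
  move=> h; have := ann_m h; rewrite [m]zpolyEprim -scalerAl linearZ /=.
  by move/eqP; rewrite mulf_eq0 (negPf nz_c) => /eqP.
exists ((lead_coef z)^-1 *: z); first by rewrite monicE lead_coefZ lead_z.
move=> q; split=> [/dvd_m /dvdpP_int [h ->] | [h ->] g'].
  by exists (lead_coef z *: h); rewrite -scalerCA scalerA lead_z scale1r.
by rewrite -!scalerAl linearZ /= -mulrA ann_z mulr0.
Qed.

(** * Parity of binomial coefficients *)

Lemma odd_natF2 n : odd n = (n%:R != 0 :> 'F_2).
Proof. by rewrite -(dvdn_pcharf (pchar_Fp (isT : prime 2))) dvdn2 negbK. Qed.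

Lemma exprDn_pow2 (q r : {poly 'F_2}) m :
  (q + r) ^+ (2 ^ m) = q ^+ (2 ^ m) + r ^+ (2 ^ m).
Proof.
have ch2 : 2%N \in [pchar {poly 'F_2}] by rewrite pchar_poly pchar_Fp.
by apply: exprDn_pchar; rewrite pnatX (pnatE _ (isT : prime 2)) ch2.
Qed.

Lemma coef_XD1_exp (R : nzRingType) n k :
  (('X + 1) ^+ n : {poly R})`_k = 'C(n, k)%:R.
Proof.
rewrite exprD1n coef_sum; have [le_kn|lt_nk] := leqP k n.
  rewrite (bigD1 (Ordinal (le_kn : k < n.+1)%N)) //= coefMn coefXn eqxx.
  rewrite big1 ?addr0 // => i; rewrite -val_eqE /= eq_sym => ne_ki.
  by rewrite coefMn coefXn (negPf ne_ki) mul0rn.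
rewrite bin_small // big1 // => i _; rewrite coefMn coefXn gtn_eqF ?mul0rn //.
by rewrite (leq_trans (ltn_ord i)).
Qed.

(** Compare coefficients in ('X + 1) ^ (j + 2 ^ m)
    = ('X + 1) ^ j * ('X^(2 ^ m) + 1) over 'F_2. *)
Lemma odd_bin_add_pow2 m j k :
  odd 'C(j + 2 ^ m, k) =
    odd 'C(j, k) (+) ((2 ^ m <= k)%N && odd 'C(j, k - 2 ^ m)).
Proof.
have -> : ((2 ^ m <= k)%N && odd 'C(j, k - 2 ^ m))
          = odd ((2 ^ m <= k) * 'C(j, k - 2 ^ m))%N.
  by case: leqP => _ /=; rewrite ?mul1n.
rewrite -oddD !odd_natF2 natrD -!coef_XD1_exp exprD exprDn_pow2 expr1n.
rewrite mulrDr mulr1 coefD coefMXn addrC coef_XD1_exp; congr (_ + _ != 0).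
by rewrite natrM -coef_XD1_exp; case: leqP; rewrite ?mul1r ?mul0r.
Qed.

Definition esign (ks : seq nat) (j : nat) : int :=
  (-1) ^+ (\sum_(k <- ks) 'C(j, k))%N.

Lemma odd_sum_bin ks j m :
  odd (\sum_(k <- ks) 'C(j + 2 ^ m, k)) =
    odd (\sum_(k <- ks) 'C(j, k))
    (+) odd (\sum_(k <- ks | (2 ^ m <= k)%N) 'C(j, k - 2 ^ m)).
Proof.
rewrite [X in _ (+) odd X]big_mkcond -oddD -big_split /=.
rewrite !(big_morph odd oddD (erefl _)); apply: eq_bigr => k _ /=.
by rewrite oddD odd_bin_add_pow2; case: leqP.
Qed.

Lemma esign_periodic ks m j :
  all (fun k => k < 2 ^ m)%N ks -> esign ks (j + 2 ^ m) = esign ks j.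
Proof.
move=> /allP lt_ks; rewrite /esign -signr_odd odd_sum_bin.
have -> : (\sum_(k <- ks | 2 ^ m <= k) 'C(j, k - 2 ^ m) = 0)%N.
  rewrite big_seq_cond big_pred0 // => k.
  by apply/negP=> /andP[/lt_ks]; rewrite ltnNge => /negPf->.
by rewrite addbF signr_odd.
Qed.

(** Take j = k0 - 2 ^ m with k0 the least of the k that are at least 2 ^ m. A
    translation by 2 ^ m adds to the exponent the numbers 'C(j, k - 2 ^ m),
    modulo 2; this is 1 for k = k0 and 0 for the larger k. *)
Lemma esign_antiperiodic ks m : sorted ltn ks -> (2 ^ m <= last 0 ks)%N ->
  exists j, esign ks (j + 2 ^ m) = - esign ks j.
Proof.
move=> sorted_ks le_last.
have sorted_hi := sorted_filter ltn_trans (fun k => 2 ^ m <= k)%N sorted_ks.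
case def_hi: [seq k <- ks | (2 ^ m <= k)%N] sorted_hi => [|k0 ks'].
  have : last 0%N ks \in [seq k <- ks | (2 ^ m <= k)%N].
    rewrite mem_filter le_last; case: (ks) le_last => [|k s _].
      by rewrite leqNgt expn_gt0.
    exact: mem_last.
  by move=> + _; rewrite def_hi.
move=> /(order_path_min ltn_trans) /allP gt_k0.
have le_k0 : (2 ^ m <= k0)%N.
  have : k0 \in [seq k <- ks | (2 ^ m <= k)%N] by rewrite def_hi mem_head.
  by rewrite mem_filter => /andP[].
exists (k0 - 2 ^ m)%N.
rewrite /esign -signr_odd odd_sum_bin -[X in _ (+) odd X]big_filter def_hi.
rewrite big_cons /= binn.
have -> : (\sum_(k <- ks') 'C(k0 - 2 ^ m, k - 2 ^ m) = 0)%N.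
  rewrite big_seq big1 // => k /gt_k0 lt_k.
  by apply: bin_small; rewrite ltn_sub2r // (leq_ltn_trans le_k0).
by rewrite addbT signrN signr_odd.
Qed.

(** * The cyclotomic factor of largest order *)

(** This is the cyclotomic polynomial of order 2 ^ m.+1, evaluated at 'X - 1. *)
Definition shifted_Phi m : {poly int} := ('X - 1) ^+ (2 ^ m) + 1.

Lemma shifted_Phi_comp m : shifted_Phi m \Po ('X + 1) = 'X^(2 ^ m) + 1.
Proof.
by rewrite rmorphD rmorphXn rmorphB /= rmorph1 comp_polyX addrK.
Qed.

Lemma size_shifted_Phi m : size (shifted_Phi m) = (2 ^ m).+1.
Proof.
have sz : size (('X - 1) ^+ (2 ^ m) : {poly int}) = (2 ^ m).+1.
  by rewrite size_exp_XsubC.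
by rewrite size_polyDl // sz size_poly1 ltnS expn_gt0.
Qed.

Lemma monic_shifted_Phi m : shifted_Phi m \is monic.
Proof.
rewrite monicE lead_coefDl; last first.
  by rewrite size_exp_XsubC size_poly1 ltnS expn_gt0.
by rewrite -monicE monic_exp ?monicXsubC.
Qed.

Lemma irreducible_shifted_Phi m : (0 < m)%N -> irreducible_poly (shifted_Phi m).
Proof.
move=> m_gt0; apply: (@eisenstein_crit 2) => //.
- by rewrite size_shifted_Phi eqSS -lt0n expn_gt0.
- by rewrite (monicP (monic_shifted_Phi m)).
- rewrite -horner_coef0 !hornerE /= -signr_odd oddX /= orbF.
  by rewrite (gtn_eqF m_gt0).
move=> i; rewrite size_shifted_Phi /= => lt_i.
(* Modulo 2, ('X - 1) ^+ (2 ^ m) + 1 = 'X^(2 ^ m) + 2 = 'X^(2 ^ m). *)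
rewrite (dvdz_pcharf (pchar_Fp (isT : prime 2))) -coef_map rmorphD rmorphXn.
rewrite rmorphB /= map_polyX rmorph1 exprDn_pow2 -signr_odd oddX orbF.
rewrite (gtn_eqF m_gt0) expr0 -addrA -polyCD (_ : 1 + 1 = 0 :> 'F_2).
  by rewrite addr0 coefXn ltn_eqF.
exact/val_inj.
Qed.

(** * Powers of 1 + u for u of order a power of 2 *)

(** In the field with p ^ (totient M) elements, Euler's theorem makes M divide
    the order of the cyclic multiplicative group. *)
Lemma finField_prim_root p M : prime p -> coprime p M -> (0 < M)%N ->
  exists (L : finFieldType) (z : L), p \in [pchar L] /\ M.-primitive_root z.
Proof.
move=> p_pr co_pM M_gt0.
have tM_gt0 : (0 < totient M)%N by rewrite totient_gt0.
have [L chL cardL] := pPrimePowerField p_pr tM_gt0.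
have card_gt1 : (1 < #|L|)%N := finNzRing_gt1 L.
have expL (x : L) : x != 0 -> x ^+ #|L|.-1 = 1.
  move=> nz_x; apply: (mulfI nz_x); rewrite mulr1 -exprS prednK ?expf_card //.
  exact: ltnW.
have /hasP[z _ prim_z] : has #|L|.-1.-primitive_root (rem 0 (enum L)).
  apply: has_prim_root; rewrite ?rem_uniq ?enum_uniq //.
  - by rewrite -ltnS prednK // ltnW.
  - apply/allP=> x; rewrite mem_rem_uniq ?enum_uniq // => /andP[nz_x _].
    by rewrite unity_rootE expL.
  - by rewrite size_rem ?mem_enum // -cardE.
have M_dvd : (M %| #|L|.-1)%N.
  rewrite cardL -subn1 -eqn_mod_dvd ?expn_gt0 ?prime_gt0 //.
  by rewrite Euler_exp_totient.
by exists L, (z ^+ (#|L|.-1 %/ M)); split=> //; apply: dvdn_prim_root.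
Qed.

(** In a cyclic group of order 2 ^ m.+1, the elements killed by 2 ^ m are the
    squares. *)
Lemma sqrt_of_pow2_root (F : fieldType) m (z : F) s (u : F) :
    (2 ^ m.+1).-primitive_root z -> (s < m)%N -> u ^+ (2 ^ s) = -1 ->
  exists w, u = w ^+ 2.
Proof.
move=> prim_z lt_sm us.
have uh : u ^+ (2 ^ m) = 1.
  rewrite -(subnKC lt_sm) addSn expnS expnD mulnCA exprM us.
  by rewrite exprM sqrrN !expr1n.
have [[k _] /= def_u] : {k : 'I_(2 ^ m.+1) | u = z ^+ k}.
  by apply: (prim_rootP prim_z); rewrite expnSr exprM uh expr1n.
have : (2 ^ m.+1 %| k * 2 ^ m)%N.
  by rewrite (prim_order_dvd prim_z) exprM -def_u uh.
rewrite expnS dvdn_pmul2r ?expn_gt0 // => /dvdnP[l def_k].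
by exists (z ^+ l); rewrite -exprM -def_k.
Qed.

(** With v ^ 2 = - u, 1 + u = (1 + v) * (1 - v). *)
Lemma exp_1D_split (R : comNzRingType) N (v u : R) : - u = v ^+ 2 ->
  (forall w, w ^+ 2 = - u -> (1 + w) ^+ N = 1) -> (1 + u) ^+ N = 1.
Proof.
move=> def_u roots1; have -> : 1 + u = (1 + v) * (1 + - v).
  by rewrite [RHS]mulrC -subr_sqr expr1n -def_u opprK.
by rewrite exprMn !roots1 ?mulr1 ?sqrrN.
Qed.

(** Downward induction on s: if u ^ (2 ^ s) = -1 with 0 < s < m then - u has the
    same property, so it is a square, and its square roots w satisfy
    w ^ (2 ^ s.+1) = -1. *)
Lemma exp_1D_descent (F : fieldType) m (z : F) N :
    (2 ^ m.+1).-primitive_root z ->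
    (forall u : F, u ^+ (2 ^ m) = -1 -> (1 + u) ^+ N = 1) ->
  forall s (u : F), (0 < s <= m)%N -> u ^+ (2 ^ s) = -1 -> (1 + u) ^+ N = 1.
Proof.
move=> prim_z Nm s u /andP[s_gt0 le_sm]; rewrite -(subKn le_sm).
have : (m - s < m)%N by rewrite ltn_subrL s_gt0 (leq_trans s_gt0).
elim: (m - s)%N u => [|d IHd] u; first by rewrite subn0 => _; apply: Nm.
move=> lt_dm; set t := (m - d.+1)%N => ut.
have t_gt0 : (0 < t)%N by rewrite subn_gt0.
have def_t : (m - d = t.+1)%N by rewrite subnSK // ltnW.
have Nut : (- u) ^+ (2 ^ t) = -1.
  by rewrite exprNn -signr_odd oddX (gtn_eqF t_gt0) mul1r.
have lt_tm : (t < m)%N by rewrite ltn_subrL (leq_ltn_trans _ lt_dm).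
have [v def_u] := sqrt_of_pow2_root prim_z lt_tm Nut.
apply: (exp_1D_split def_u) => w def_w; apply: IHd; first exact: ltnW.
by rewrite def_t expnS exprM def_w.
Qed.

(** Such a u, if it is not 1, satisfies u ^ (2 ^ s) = -1 for some s, and s is
    positive because u is not -1. *)
Lemma exp_1D_pow2_root (F : fieldType) m (z : F) N :
    (0 < m)%N -> (2 ^ m.+1).-primitive_root z ->
    (forall u : F, u ^+ (2 ^ m) = -1 -> (1 + u) ^+ N = 1) ->
  forall u : F, u ^+ (2 ^ m.+1) = 1 -> u != -1 -> (1 + u) ^+ N = 1.
Proof.
move=> m_gt0 prim_z Nm; have descent := exp_1D_descent prim_z Nm.
move=> u; elim: {-2}m.+1 (leqnn m.+1) u => [|s IHs] le_sm u us nz_u.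
  (* Here u = 1, and 1 + 1 = (1 + i) * (1 - i) with i a square root of -1. *)
  move: us; rewrite expr1 => ->.
  have [v v2] := sqrt_of_pow2_root prim_z m_gt0 (expr1 (-1)).
  by apply: (exp_1D_split v2) => w w2; apply: (descent 1); rewrite ?m_gt0.
have /eqP : (u ^+ (2 ^ s)) ^+ 2 = 1 by rewrite -exprM -expnSr.
rewrite sqrf_eq1 => /orP[]/eqP; first by move/IHs; apply; rewrite // ltnW.
case: s {IHs} le_sm us => [|s] le_sm _; last exact: descent.
by rewrite expr1 => /eqP; rewrite (negPf nz_u).
Qed.

(** * Powers of matrices and their reduction modulo p *)

Lemma expmx_one_root (F : fieldType) d (A : 'M[F]_d) N x :
  A ^+ N = 1%:M -> root (char_poly A) x -> x ^+ N = 1.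
Proof.
move=> AN; rewrite -eigenvalue_root_char => /eigenvalueP[v vA nz_v].
have vAX k : v *m A ^+ k = x ^+ k *: v.
  elim: k => [|k IHk]; first by rewrite !expr0 mulmx1 scale1r.
  by rewrite exprS -[A * _]/(A *m _) mulmxA vA -scalemxAl IHk scalerA -exprS.
apply/eqP; rewrite -subr_eq0; apply: contraNT nz_v => nz.
have /eqP := vAX N; rewrite AN mulmx1 -subr_eq0 -{1}[v]scale1r -scalerBl.
by rewrite scaler_eq0 subr_eq0 eq_sym -subr_eq0 (negPf nz).
Qed.

Lemma dvdp_char_poly_expmx (F : fieldType) d (A : 'M[F]_d) N :
  char_poly A %| 'X^N - 1 -> A ^+ N = 1%:M.
Proof.
case: d A => [|d] A; first by rewrite [A ^+ N]flatmx0 [1%:M]flatmx0.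
move=> /dvdpP[q def_q].
have : horner_mx A ('X^N - 1) = 0.
  by rewrite def_q rmorphM /= Cayley_Hamilton mulr0.
by rewrite rmorphB rmorph1 rmorphXn /= horner_mx_X => /subr0_eq.
Qed.

Lemma mx_one_mod_map (R : nzRingType) p d (A : 'M[int]_d) : p \in [pchar R] ->
  mx_one_mod p A <-> map_mx intr A = 1%:M :> 'M[R]_d.
Proof.
move=> chR; split=> [A1 | A1 i j].
  apply/matrixP=> i j; have /eqP := A1 i j.
  rewrite eqz_mod_dvd (dvdz_pcharf chR) rmorphB subr_eq0 => /eqP.
  by rewrite !mxE rmorph_nat.
have /matrixP/(_ i j) := A1; rewrite !mxE => Aij.
apply/eqP; rewrite eqz_mod_dvd (dvdz_pcharf chR) rmorphB subr_eq0 /= Aij.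
by rewrite rmorph_nat.
Qed.

Lemma map_expmx (R S : nzRingType) (f : {rmorphism R -> S}) d (A : 'M[R]_d) N :
  map_mx f (A ^+ N) = map_mx f A ^+ N.
Proof.
elim: N => [|N IHN]; first by rewrite !expr0 map_mx1.
by rewrite !exprS -IHN; apply: map_mxM.
Qed.

(** * The minimal recurrence *)

Lemma comp_polyXB1K (R : comNzRingType) (q : {poly R}) :
  (q \Po ('X - 1)) \Po ('X + 1) = q.
Proof.
by rewrite -comp_polyA rmorphB /= comp_polyX rmorph1 addrK comp_polyXr.
Qed.

Lemma comp_polyXD1K (R : comNzRingType) (q : {poly R}) :
  (q \Po ('X + 1)) \Po ('X - 1) = q.
Proof.
by rewrite -comp_polyA rmorphD /= comp_polyX rmorph1 subrK comp_polyXr.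
Qed.

(** The factor 'X is the shift of index from n to n.+1; substituting 'X + 1
    turns the form of S into that of the signs and is an automorphism. *)
Lemma annihilates_expsum ks q :
  annihilates (fun n => expsum ks n.+1) q <->
  annihilates (esign ks) (('X * q) \Po ('X + 1)).
Proof.
have E h : umbral (fun n => expsum ks n.+1) h
           = umbral (esign ks) (('X * h) \Po ('X + 1)).
  by rewrite umbral_shift; apply: umbral_binomial.
split=> ann h; last by rewrite E mulrA rmorphM /= ann.
by rewrite -[h]comp_polyXB1K -rmorphM /= -mulrA -E ann.
Qed.

Lemma annihilates_esign ks m : all (fun k => k < 2 ^ m)%N ks ->
  annihilates (esign ks) ('X^(2 ^ m) - 1).
Proof.
move=> lt_ks; apply: annihilatesXn => n.
by rewrite mulrBl mul1r -exprD raddfB /= !umbralXn addnC esign_periodic ?subrr.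
Qed.

Lemma monic_annihilator_expsum ks m : all (fun k => k < 2 ^ m.+1)%N ks ->
  exists g : {poly int}, [/\ g \is monic, 'X * g = ('X - 1) ^+ (2 ^ m.+1) - 1
    & annihilates (fun n => expsum ks n.+1) g].
Proof.
move=> lt_ks; pose f : {poly int} := ('X - 1) ^+ (2 ^ m.+1) - 1.
have mon_f : f \is monic.
  rewrite monicE lead_coefDl; last first.
    by rewrite size_exp_XsubC size_polyN size_poly1 ltnS expn_gt0.
  by rewrite -monicE monic_exp ?monicXsubC.
have /factor_theorem[g def_f] : root f 0.
  by rewrite /f rootE !hornerE -signr_odd oddX subrr.
rewrite subr0 mulrC in def_f.
exists g; split=> //; first by move: mon_f; rewrite def_f monicMl ?monicX.
apply/annihilates_expsum; rewrite -def_f rmorphB rmorphXn rmorphB /=.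
by rewrite comp_polyX rmorph1 addrK; apply: annihilates_esign.
Qed.

Lemma all_le_last s : sorted ltn s -> all (fun k => k <= last 0 s)%N s.
Proof.
rewrite (sorted_pairwise ltn_trans); case/lastP: s => // s x.
rewrite pairwise_rcons last_rcons all_rcons leqnn => /andP[lt_x _] /=.
by apply: sub_all lt_x => k /ltnW.
Qed.

(** If the irreducible Phi = [shifted_Phi m] did not divide 'X * q, some nonzero
    constant would be a combination of the two. After substituting 'X + 1,
    'X * q annihilates the signs, and so does Phi times 'X^(2 ^ m) - 1.
    Hence 'X^(2 ^ m) - 1 itself would annihilate the signs, making them periodic
    of period 2 ^ m. *)
Lemma shifted_Phi_dvd_annihilator ks m q :
    (0 < m)%N -> sorted ltn ks -> (2 ^ m <= last 0 ks < 2 ^ m.+1)%N ->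
    annihilates (fun n => expsum ks n.+1) q ->
  exists h, q = h * shifted_Phi m.
Proof.
move=> m_gt0 sorted_ks /andP[le_last lt_last] /annihilates_expsum ann_q.
have irr_Phi := irreducible_shifted_Phi m_gt0.
apply/(Pdiv.IdomainMonic.dvdpP (monic_shifted_Phi m)).
have co_X : coprimep (shifted_Phi m) 'X.
  rewrite coprimepX rootE !hornerE /= -signr_odd oddX.
  by rewrite (gtn_eqF m_gt0).
rewrite -(Gauss_dvdpr _ co_X); apply: contraT.
rewrite -(irreducible_poly_coprime _ irr_Phi).
move=> /Bezout_coprimepP[[u v] /= /eqp_size]; rewrite size_poly1.
move=> /eqP/size_poly1P[c nz_c def_c].
(* The form is evaluated at 'X^j, where the periodicity fails. *)
have [j flip_j] := esign_antiperiodic sorted_ks le_last.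
have ann_M : annihilates (esign ks) ('X^(2 ^ m.+1) - 1).
  apply: annihilates_esign; apply: sub_all (all_le_last sorted_ks) => k le_k.
  exact: leq_ltn_trans lt_last.
have : umbral (esign ks) (c *: (('X^(2 ^ m) - 1) * 'X^j)) = 0.
  rewrite -mul_polyC -[c%:P](comp_polyC _ ('X + 1)) -def_c rmorphD !rmorphM /=.
  rewrite shifted_Phi_comp mulrDl raddfD /= -(rmorphM _ 'X q) /=.
  set w := u \Po _; set w' := v \Po _.
  rewrite mulrA -[w * _ * _]mulrA (mulrC w) (mulrC w') -!mulrA.
  rewrite ann_q addr0 mulrA [_ * ('X^(2 ^ m) - 1)]mulrC -subr_sqr expr1n.
  by rewrite -exprM -expnSr ann_M.
rewrite linearZ /= mulrBl mul1r -exprD raddfB /= !umbralXn addnC flip_j -opprD.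
move/eqP; rewrite mulf_eq0 (negPf nz_c) oppr_eq0 -mulr2n mulrn_eq0 /=.
by rewrite /esign signr_eq0.
Qed.

(** The roots of ('X - 1) ^ M - 1 are simple: they are the 1 + z ^ i. *)
Lemma dvdp_XsubC1_pow_sub1 (F : fieldType) M (z : F) (f : {poly F}) :
    M.-primitive_root z -> (forall u, u ^+ M = 1 -> f.[1 + u] = 0) ->
  ('X - 1) ^+ M - 1 %| f.
Proof.
move=> prim_z f0.
have: 'X^M - 1 %| f \Po ('X + 1).
  rewrite -(factor_Xn_sub_1 prim_z).
  rewrite -(big_map (fun i => z ^+ i) xpredT (fun x => 'X - x%:P)).
  apply: uniq_roots_dvdp; last first.
    rewrite uniq_rootsE map_inj_in_uniq ?iota_uniq // => i j.
    rewrite !mem_index_iota => lt_i lt_j /eqP.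
    by rewrite (eq_prim_root_expr prim_z) !modn_small // => /eqP.
  apply/allP=> _ /mapP[i _ ->]; rewrite rootE horner_comp !hornerE addrC f0 //.
  by rewrite exprAC (prim_expr_order prim_z) expr1n.
move/(dvdp_comp_poly ('X - 1)); rewrite comp_polyXD1K.
by rewrite rmorphB rmorphXn /= rmorph1 comp_polyX.
Qed.

(** The minimal recurrence is the one whose polynomial generates the ideal of
    annihilators; the other two conclusions are the bounds, for divisibility,
    through which alone its period is computed. *)
Lemma minimal_recurrence_expsum ks m :
    (0 < m)%N -> sorted ltn ks -> (2 ^ m <= last 0 ks < 2 ^ m.+1)%N ->
  exists a, [/\ unique (minimal_recurrence (expsum ks)) a,
    exists h, recurrence_poly a = h * shifted_Phi m
    & exists h, 'X * (h * recurrence_poly a) = ('X - 1) ^+ (2 ^ m.+1) - 1].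
Proof.
move=> m_gt0 sorted_ks bnd_ks; have [_ lt_last] := andP bnd_ks.
have lt_ks : all (fun k => k < 2 ^ m.+1)%N ks.
  apply: sub_all (all_le_last sorted_ks) => k le_k.
  exact: leq_ltn_trans lt_last.
have [g [mon_g def_g ann_g]] := monic_annihilator_expsum lt_ks.
have [chi mon_chi chiP] := principal_annihilator mon_g ann_g.
have [a def_chi] := recurrence_poly_monic mon_chi.
have rec_dvd b : satisfies_recurrence (expsum ks) b ->
    exists h, recurrence_poly b = chi * h.
  by move/satisfies_recurrenceP/chiP.
have nz_rec b : recurrence_poly b != 0.
  by rewrite monic_neq0 ?monic_recurrence_poly.
have rec_a : satisfies_recurrence (expsum ks) a.
  by apply/satisfies_recurrenceP/chiP; exists 1; rewrite mulr1.
exists a; split.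
- split=> [|b [/rec_dvd[h def_b] min_b]].
    split=> // b /rec_dvd[h def_b].
    rewrite -ltnS -!size_recurrence_poly def_chi.
    by rewrite dvdp_leq // def_b dvdp_mulIl.
  have mon_h : h \is monic.
    by rewrite -(monicMl h mon_chi) -def_b monic_recurrence_poly.
  apply: recurrence_poly_inj; rewrite def_b def_chi.
  suff -> : h = 1 by rewrite mulr1.
  have : (size (chi * h)%R <= size chi)%N.
    by rewrite -def_b -def_chi !size_recurrence_poly ltnS min_b.
  rewrite size_monicM ?monic_neq0 // (polySpred (monic_neq0 mon_h)) addnS /=.
  rewrite -[X in (_ <= X)%N]addn0 leq_add2l leqn0 => sz_h.
  have /size_poly1P[c _ def_h] : size h == 1.
    by rewrite (polySpred (monic_neq0 mon_h)) (eqP sz_h).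
  by move/monicP: mon_h; rewrite def_h lead_coefC => ->.
- rewrite def_chi; apply: (shifted_Phi_dvd_annihilator m_gt0 sorted_ks bnd_ks).
  by apply/chiP; exists 1; rewrite mulr1.
by have /chiP[h def_h] := ann_g; exists h; rewrite def_chi [h * _]mulrC -def_h.
Qed.

(** * The period *)

(** If the power is 1, every eigenvalue is an N-th root of unity, and the
    1 + u with u ^ (2 ^ m) = -1 are eigenvalues, being roots of
    [shifted_Phi m]. Conversely, if these are N-th roots of unity then so are
    all the roots of the upper bound of the characteristic polynomial; they are
    simple, so that bound divides 'X^N - 1, and the Cayley-Hamilton theorem
    concludes. *)
Lemma mx_one_mod_companion p (L : fieldType) m (z : L) a :
    p \in [pchar L] -> (2 ^ m.+1).-primitive_root z -> (0 < m)%N ->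
    (exists h, recurrence_poly a = h * shifted_Phi m) ->
    (exists h, 'X * (h * recurrence_poly a) = ('X - 1) ^+ (2 ^ m.+1) - 1) ->
  forall N, mx_one_mod p (companionmx (recurrence_poly a) ^+ N) <->
    forall u : L, u ^+ (2 ^ m) = -1 -> (1 + u) ^+ N = 1.
Proof.
move=> chL prim_z m_gt0 [h def_h] [g def_g] N.
set A := companionmx _.
have charA : char_poly (map_mx intr A : 'M[L]_ _)
             = map_poly intr (recurrence_poly a).
  by rewrite -map_char_poly companionmxK ?monic_recurrence_poly.
rewrite (mx_one_mod_map _ chL) map_expmx; split=> [AN u u2 | Nm].
  apply: (expmx_one_root AN); rewrite charA def_h rmorphM rootM.
  apply/orP; right.
  rewrite rmorphD rmorphXn rmorphB /= map_polyX rmorph1 rootE !hornerE /=.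
  by rewrite [1 + u]addrC addrK u2 addNr.
apply: dvdp_char_poly_expmx; rewrite charA.
have mapR : map_poly (intr : int -> L) (('X - 1) ^+ (2 ^ m.+1) - 1)
          = ('X - 1) ^+ (2 ^ m.+1) - 1.
  by rewrite rmorphB rmorphXn rmorphB /= map_polyX rmorph1.
(* Both sides are multiplied by 'X, so that the upper bound becomes
   ('X - 1) ^+ (2 ^ m.+1) - 1 and the excluded value u = -1 is harmless. *)
have Xf : 'X * (map_poly intr g * map_poly intr (recurrence_poly a))
        = ('X - 1) ^+ (2 ^ m.+1) - 1 :> {poly L}.
  by rewrite -mapR -def_g !rmorphM /= map_polyX.
have : ('X : {poly L}) * (map_poly intr g * map_poly intr (recurrence_poly a))
         %| 'X * ('X^N - 1).
  rewrite Xf; apply: (dvdp_XsubC1_pow_sub1 prim_z) => u u1.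
  rewrite !hornerE /=; have [-> | nz_u] := eqVneq u (-1).
    by rewrite subrr mul0r.
  by rewrite (exp_1D_pow2_root m_gt0 prim_z Nm) // subrr mulr0.
rewrite dvdp_mul2l ?polyX_eq0 //; apply: dvdp_trans; exact: dvdp_mulIr.
Qed.

(** Nonzero elements of a finite field have finite multiplicative order. *)
Lemma exp_1D_order (L : finFieldType) h :
    (forall u : L, u ^+ h = -1 -> 1 + u != 0) ->
  exists2 N, (0 < N)%N /\ (forall u : L, u ^+ h = -1 -> (1 + u) ^+ N = 1)
    & forall M, (0 < M)%N ->
      (forall u : L, u ^+ h = -1 -> (1 + u) ^+ M = 1) -> (N <= M)%N.
Proof.
move=> nz_u.
pose P N :=
  (0 < N)%N && [forall u : L, (u ^+ h == -1) ==> ((1 + u) ^+ N == 1)].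
have PP N : reflect
    ((0 < N)%N /\ (forall u : L, u ^+ h = -1 -> (1 + u) ^+ N = 1)) (P N).
  apply: (iffP andP) => -[N_gt0 PN]; split=> //.
    by move=> u /eqP uh; apply/eqP; have /forallP/(_ u)/implyP := PN; apply.
  by apply/forallP=> u; apply/implyP=> /eqP/PN->.
have exP : exists N, P N.
  exists #|L|.-1; apply/PP; split=> [|u /nz_u nz].
    by rewrite -ltnS prednK // ?finNzRing_gt1 // ltnW // finNzRing_gt1.
  apply: (mulfI nz); rewrite mulr1 -exprS prednK ?expf_card //.
  exact/ltnW/finNzRing_gt1.
exists (ex_minn exP); first by case: ex_minnP => N /PP.
by case: ex_minnP => N _ minN M M_gt0 PM; apply/minN/PP.
Qed.

(** All admissible sequences s whose largest entry lies in the same dyadic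
    interval share their order condition, hence the order itself. *)
Lemma weak_pisano_period_dyadic p m : prime p -> (2 < p)%N -> (0 < m)%N ->
  exists N, forall s, sorted ltn s -> (2 ^ m <= last 0 s < 2 ^ m.+1)%N ->
    weak_pisano_period p s N.
Proof.
move=> p_prime p_gt2 m_gt0.
have co_pM : coprime p (2 ^ m.+1).
  by rewrite coprimeXr // prime_coprime // dvdn_prime2 // gtn_eqF.
have [L [z [chL prim_z]]] := finField_prim_root p_prime co_pM (expn_gt0 _ _).
(* This is where p must be odd: u = -1 would give 1 = -1. *)
have nz_1D (u : L) : u ^+ (2 ^ m) = -1 -> 1 + u != 0.
  move=> u2; rewrite addrC addr_eq0; apply/eqP=> def_u; move: u2.
  rewrite def_u -signr_odd oddX (gtn_eqF m_gt0) => /eqP.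
  rewrite -subr_eq0 opprK.
  rewrite expr0 -(natrD _ 1 1) -(dvdn_pcharf chL) => /(@dvdn_leq p 2 isT).
  by rewrite leqNgt p_gt2.
have [N [N_gt0 PN] minN] := exp_1D_order nz_1D; exists N => s sorted_s bnd_s.
have [a [min_a Phi_a a_dvd]] :=
  minimal_recurrence_expsum m_gt0 sorted_s bnd_s.
have A1 := mx_one_mod_companion chL prim_z m_gt0 Phi_a a_dvd.
exists a => //; split=> //; first exact/A1.
by move=> M M_gt0 /A1; apply: minN.
Qed.

Local Close Scope ring_scope.

Theorem theorem4p8 (p : nat) (ks : seq nat)
    (p_prime : prime p) (p_gt2 : (2 < p)%N)
    (ks_ge1 : all (fun k => 1 <= k)%N ks) (ks_lt : sorted ltn ks)
    (ks_gt1 : (1 < last 0 ks)%N) :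
  let r := (trunc_log 2 (last 0 ks)).+1 in
  exists N : nat,
    weak_pisano_period p ks N /\ weak_pisano_period p [:: 2 ^ (r - 1)]%N N.
Proof.
rewrite /= subn1 /=; set m := trunc_log 2 _.
have m_gt0 : 0 < m by rewrite trunc_log_gt0.
have [N period] := weak_pisano_period_dyadic p_prime p_gt2 m_gt0.
exists N; split; apply: period => //; last by rewrite /= leqnn ltn_exp2l /=.
by apply: trunc_log_bounds; rewrite // ltnW.
Qed.
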